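(* Let $q,q'$ be prime powers and $n,r,n',r'$ integers with $n>2r$, $n'>2r'$ and $[n]_q/[r]_q=[n']_{q'}/[r']_{q'}$. If there is a homomorphism $qK_{n:r}\to q'K_{n':r'}$, then \[\left\{\frac{[k]_q}{[r]_q}: k\in[r]\right\}\subseteq\left\{\frac{[k']_{q'}}{[r']_{q'}}: k'\in[r']\right\}.\] In particular, $[n']_{q'}$ and $[r']_{q'}$ are integer multiples of $[n]_q$ and $[r]_q$, respectively.
   Context: $[k]_q:=\frac{q^k-1}{q-1}=\sum_{i=0}^{k-1}q^i$ and $[r]=\{1,\dots,r\}$. The $q$-Kneser graph $qK_{n:r}$ has as vertices the $r$-dimensional subspaces of $\mathbb{F}_q^n$, two being adjacent iff their intersection is the zero subspace. A homomorphism is an adjacency-preserving map between vertex sets. *)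

(* Defs.v *)
From HB Require Import structures.
From mathcomp Require Import all_boot all_order all_algebra.
Set Implicit Arguments. Unset Strict Implicit. Unset Printing Implicit Defensive.

Definition qint (q k : nat) : nat := \sum_(i < k) q ^ i.

Definition qK_vertex (F : finFieldType) (n r : nat) (U : {vspace 'rV[F]_n}) : Prop :=
  \dim U = r.

Definition qK_adj (F : finFieldType) (n : nat) (U W : {vspace 'rV[F]_n}) : Prop :=
  (U :&: W)%VS = 0%VS.

(* A graph homomorphism qK_{n:r}(F) -> qK_{n':r'}(F'), given as a map on
   subspaces that sends vertices to vertices and preserves adjacency between
   vertices (its values on non-vertices are irrelevant). *)
Definition qK_hom (F F' : finFieldType) (n r n' r' : nat)
  (f : {vspace 'rV[F]_n} -> {vspace 'rV[F']_n'}) : Prop :=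
  (forall U, qK_vertex r U -> qK_vertex r' (f U)) /\
  (forall U W, qK_vertex r U -> qK_vertex r W -> qK_adj U W -> qK_adj (f U) (f W)).

(* Main.v *)
(* For a line p' of F'^n', the set A of the r-spaces U with p' <= f U is
   intersecting. By the ratio bound |A| / N <= [r]_q / [n]_q, and averaging over p'
   with [r]_q / [n]_q = [r']_q' / [n']_q' forces equality. Equality puts the
   characteristic vector of A in the span of the functions of degree at most 1,
   i.e. 1_A (U) is the sum of some a(x) over the lines x of U. If U is in A and x is
   a line outside U, then some (r+1)-space Z contains x and meets U trivially (here
   2r < n is used); no r-space of Z lies in A, so a vanishes on Z. Hence a is
   supported on every member of A, and A consists of all the r-spaces through one
   line phi p'. The fibres of phi have constant total size over every r-space, hence
   constant size m, with m [r]_q = [r']_q' and m [n]_q = [n']_q'. A k-space is an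
   intersection of two r-spaces U, W, and then m [k]_q is the number of lines of
   f U :&: f W. *)

Require Import Defs.
From HB Require Import structures.
From mathcomp Require Import all_boot all_order all_algebra all_field.
From mathcomp Require Import ring lra zify.
Set Implicit Arguments. Unset Strict Implicit. Unset Printing Implicit Defensive.
Import Order.TTheory GRing.Theory Num.Theory.

Local Open Scope ring_scope.

(** * Subspaces of a finite space as a finite type, so that sets of them and sums over them are
    available *)

HB.instance Definition _ (F : finFieldType) (vT : vectType F) :=
  Countable.copy {vspace vT} (can_type (@VectorInternalTheory.vs2mxK F vT)).
HB.instance Definition _ (F : finFieldType) (vT : vectType F) : isFinite {vspace vT} :=
  CanIsFinite (@VectorInternalTheory.vs2mxK F vT).

(** * Counting subspaces *)

Section SubspaceCount.
Variables (F : finFieldType) (n : nat).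
Implicit Types (J U W Z : {vspace 'rV[F]_n}).
Local Notation q := (#|F|%:R : rat).

Lemma card_sub U : #|[set v in U]| = (#|F| ^ \dim U)%N.
Proof. by rewrite cardsE; exact: card_vspace. Qed.

Lemma cardF_gt1 : 1 < q.
Proof. by rewrite ltr1n; exact: finNzRing_gt1. Qed.

Lemma expq_lt (i j : nat) : (i < j)%N -> q ^+ i < q ^+ j.
Proof. by move=> ij; rewrite ltr_eXn2l ?cardF_gt1. Qed.

(** One set serves every count below: [J] is forced in, [U] is avoided, and either constraint is
    switched off by taking the zero subspace. *)
Definition between J U Z (k : nat) : {set {vspace 'rV[F]_n}} :=
  [set W | [&& (J <= W)%VS, (W <= Z)%VS, \dim W == k & (W :&: U == 0)%VS]].

Lemma dimv_line (J : {vspace 'rV[F]_n}) v : v \notin J -> \dim (J + <[v]>)%VS = (\dim J).+1.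
Proof.
move=> vJ; have v0 : v != 0 by apply: contraNneq vJ => ->; rewrite mem0v.
rewrite dimv_disjoint_sum ?dim_vline ?v0 ?addn1 //.
apply/eqP; rewrite -subv0; apply/subvP => w /memv_capP [wJ /vlineP [t wt]].
rewrite memv0 wt scaler_eq0 (negPf v0) orbF; apply: contraNT vJ => t0.
by rewrite -[v](scalerK t0) -wt memvZ.
Qed.

(** The map [v |-> J + <[v]>] sends the vectors of [Z] outside [J + U] to these subspaces, and the
    fibre over [J'] is [J'] minus [J]. *)
Lemma card_between_succ J U Z :
  (J <= Z)%VS -> (U <= Z)%VS -> (J :&: U = 0)%VS ->
  #|between J U Z (\dim J).+1|%:R * (q ^+ (\dim J).+1 - q ^+ \dim J)
    = q ^+ \dim Z - q ^+ (\dim J + \dim U).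
Proof.
move=> JZ UZ JU.
pose A := [set v in Z] :\: [set v in (J + U)%VS].
have JUZ : (J + U <= Z)%VS by rewrite subv_add JZ.
have cardD (X Y : {vspace 'rV[F]_n}) : (X <= Y)%VS ->
    #|[set v in Y] :\: [set v in X]|%:R = q ^+ \dim Y - q ^+ \dim X :> rat.
  move=> XY; rewrite cardsD (setIidPr _) ?natrB ?card_sub ?natrX //.
    by rewrite leq_exp2l ?dimvS // finNzRing_gt1.
  by apply/subsetP => v; rewrite !inE; apply: (subvP XY).
rewrite -(dimv_disjoint_sum JU) -(cardD _ _ JUZ) -/A -[in RHS]sum1_card natr_sum.
rewrite (partition_big (fun v => J + <[v]>)%VS (mem (between J U Z (\dim J).+1))) /=; last first.
  move=> v; rewrite !inE => /andP [vJU vZ].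
  have vJ : v \notin J by apply: contra vJU; apply: subvP; exact: addvSl.
  rewrite addvSl subv_add JZ -memvE vZ dimv_line // eqxx /=.
  rewrite -subv0; apply/subvP => w /memv_capP [/memv_addP [a aJ [b /vlineP [t ->]] ->] wU].
  have [t0|t0] := eqVneq t 0.
    by rewrite t0 scale0r addr0 in wU *; rewrite -JU memv_cap aJ.
  case/negP: vJU; rewrite -(scalerK t0 v) memvZ // addvC.
  by rewrite -[t *: v](addKr a) addrC memv_add // memvN.
rewrite mulr_natl -[RHS](@eq_bigr _ _ _ _ _ _ (fun=> q ^+ (\dim J).+1 - q ^+ \dim J)).
  by rewrite sumr_const.
move=> J'; rewrite inE => /and4P [JJ' J'Z /eqP dJ' /eqP J'U].
rewrite -natr_sum sum1_card -dJ' -(cardD _ _ JJ'); congr _%:R.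
apply: eq_card => v; rewrite [RHS]unfold_in /= !inE.
apply/andP/andP => [[vJ vJ']|[/andP [vJU vZ] /eqP vJ']]; last first.
  rewrite -vJ' (subvP (addvSr _ _)) ?memv_line //; split=> //.
  by apply: contra vJU; apply: subvP; exact: addvSl.
split.
  rewrite (subvP J'Z) // andbT; apply: contra vJ => /memv_addP [a aJ [b bU vab]].
  suff b0 : b = 0 by rewrite vab b0 addr0.
  apply/eqP; rewrite -memv0 -J'U memv_cap bU andbT.
  by rewrite -[b](addKr a) -vab addrC memvB // (subvP JJ').
by rewrite eqEdim subv_add JJ' -memvE vJ' dimv_line // dJ' leqnn.
Qed.

(** Induction on [k - \dim J]: the pairs [J' <= W] with [J'] one dimension above [J] are counted
    from [W] and from [J']. *)
Lemma card_between J U Z k :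
  (J <= Z)%VS -> (U <= Z)%VS -> (J :&: U = 0)%VS -> (\dim J <= k)%N ->
  #|between J U Z k|%:R =
    \prod_(\dim J <= i < k) ((q ^+ \dim Z - q ^+ (i + \dim U)) / (q ^+ k - q ^+ i)).
Proof.
move=> JZ UZ; move: {2}(k - \dim J)%N (erefl (k - \dim J)%N) => d.
elim: d J JZ => [|d IH] J JZ kJ JU Jk.
  have dJ : \dim J = k by lia.
  rewrite -dJ big_geq //; suff -> : between J U Z (\dim J) = [set J] by rewrite cards1.
  apply/setP=> W; rewrite !inE; apply/and4P/eqP=> [[JW WZ /eqP dW _]|->].
    by apply/eqP; rewrite eq_sym eqEdim JW dW leqnn.
  by rewrite subvv JZ JU !eqxx.
have ltJk : (\dim J < k)%N by lia.
rewrite big_ltn //.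
set P := \prod_(_ <= _ < _) _.
(* A [J'] inside [W] avoids [U] automatically, so the inner count from the side of [W] has nothing
   to avoid. *)
have key : \sum_(W in between J U Z k) (#|between J 0 W (\dim J).+1|%:R : rat)
         = \sum_(J' in between J U Z (\dim J).+1) #|between J' U Z k|%:R.
  transitivity (\sum_(W in between J U Z k)
      \sum_(J' in between J U Z (\dim J).+1 | J' \in between J 0 W (\dim J).+1) (1 : rat)).
    apply: eq_bigr => W; rewrite !inE => /and4P [JW WZ dW /eqP WU].
    rewrite -sum1_card natr_sum; apply: eq_bigl => J'; rewrite !inE capv0 eqxx andbT.
    case JJ' : (J <= J')%VS => //=; case J'W : (J' <= W)%VS => //=; last by rewrite !andbF.
    rewrite (subv_trans J'W WZ) /=; case: (_ == _.+1) => //=; symmetry.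
    by rewrite andbT -subv0 -WU capvS ?subvv.
  rewrite (exchange_big_dep (mem (between J U Z (\dim J).+1))) /=; last first.
    by move=> W J' _ /andP [].
  apply: eq_bigr => J' J'in; rewrite -sum1_card natr_sum; apply: eq_bigl => W.
  rewrite J'in andTb; move: J'in; rewrite !inE capv0 eqxx andbT.
  case/and4P => JJ' J'Z -> _ /=; rewrite JJ' andbT /=.
  case J'W : (J' <= W)%VS => /=; last by rewrite andbF.
  by rewrite (subv_trans JJ' J'W) andbT.
have pos : 0 < q ^+ k - q ^+ \dim J by rewrite subr_gt0 expq_lt.
have pos1 : 0 < q ^+ (\dim J).+1 - q ^+ \dim J by rewrite subr_gt0 expq_lt.
apply: (mulIf (lt0r_neq0 pos)); rewrite mulrAC divfK ?lt0r_neq0 //.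
rewrite -card_between_succ // mulrAC.
rewrite [X in _ = X * _](_ : _ = \sum_(J' in between J U Z (\dim J).+1) #|between J' U Z k|%:R).
  rewrite -key mulr_suml mulr_natl -sumr_const; apply: eq_bigr => W.
  rewrite inE => /and4P [JW WZ /eqP dW _].
  by rewrite card_between_succ ?capv0 ?sub0v // dimv0 addn0 dW.
rewrite mulr_natl -sumr_const; apply: eq_bigr => J'.
rewrite inE => /and4P [JJ' J'Z /eqP dJ' /eqP J'U].
rewrite IH ?dJ' //; lia.
Qed.
End SubspaceCount.

(** * The ratio bound for a self-adjoint operator that is triangular along a flag *)

Section Flag.
Variables (R : realFieldType) (E : vectType R) (ip : E -> E -> R).
Hypothesis ipC : forall f g, ip f g = ip g f.
Hypothesis ip_linear : forall h, linear_for *%R (ip^~ h).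
Hypothesis ip_gt0 : forall f, f != 0 -> 0 < ip f f.

Let ipDl f g h : ip (f + g) h = ip f h + ip g h.
Proof. by have := ip_linear h 1 f g; rewrite /= scale1r mul1r. Qed.

Let ip0l h : ip 0 h = 0.
Proof. by have := ipDl 0 0 h; rewrite addr0 => e; lra. Qed.

Let ipZl a f h : ip (a *: f) h = a * ip f h.
Proof. by have := ip_linear h a f 0; rewrite /= ip0l !addr0. Qed.

Let ipBl f g h : ip (f - g) h = ip f h - ip g h.
Proof. by rewrite -scaleN1r ipDl ipZl mulN1r. Qed.

Let ipDr f g h : ip h (f + g) = ip h f + ip h g.
Proof. by rewrite ipC ipDl !(ipC h). Qed.

Let ipZr a f h : ip h (a *: f) = a * ip h f.
Proof. by rewrite ipC ipZl (ipC h). Qed.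

Let ip_ge0 f : 0 <= ip f f.
Proof. by have [->|/ip_gt0/ltW//] := eqVneq f 0; rewrite ip0l. Qed.

Let ip_eq0 f : ip f f = 0 -> f = 0.
Proof. by move=> f0; apply: contra_eq f0 => /ip_gt0 /lt0r_neq0. Qed.

Definition orth (U : {vspace E}) f := forall h, h \in U -> ip f h = 0.

(** Gram-Schmidt along a spanning list: a new vector [x] contributes only through [x - y], its part
    orthogonal to the vectors already treated. *)
Lemma orthogonal_decomposition (U : {vspace E}) f :
  exists2 g, g \in U & orth U (f - g).
Proof.
rewrite -(span_basis (vbasisP U)).
elim: (tval (vbasis U)) f => [|x s IH] f.
  exists 0; first exact: mem0v.
  by move=> h; rewrite span_nil memv0 => /eqP ->; rewrite ipC ip0l.
have [g gs fg] := IH f; have [y ys xy] := IH x.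
rewrite span_cons; set t := ip f (x - y) / ip (x - y) (x - y).
exists (t *: x + (g - t *: y)).
  by rewrite memv_add ?memvB ?memvZ // memv_line.
(* If [x = y] the quotient [t] is a default value, and the identity still holds because both sides
   vanish. *)
have tP : t * ip (x - y) (x - y) = ip f (x - y).
  have [->|/ip_gt0/lt0r_neq0 xy0] := eqVneq (x - y) 0; last by rewrite /t divfK.
  by rewrite !(ipC _ 0) !ip0l mulr0.
have -> : f - (t *: x + (g - t *: y)) = (f - g) - t *: (x - y).
  by rewrite scalerBr -[RHS]addrA -opprD addrCA.
move=> h /memv_addP [_ /vlineP [c ->] [h0 h0s ->]].
have -> : c *: x + h0 = c *: (x - y) + (c *: y + h0).
  by rewrite addrA -scalerDr subrK.
have h1s : c *: y + h0 \in <<s>>%VS by rewrite memvD ?memvZ.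
have gx : ip g (x - y) = 0 by rewrite ipC xy.
by rewrite ipDr ipZr !ipBl !ipZl tP gx -ipBl fg // xy //; ring.
Qed.

Variable D : E -> E.
Hypothesis DD : {morph D : f g / f + g}.
Hypothesis DZ : forall a, {morph D : f / a *: f}.
Hypothesis D_sym : forall f g, ip (D f) g = ip f (D g).
Variables (r : nat) (L : nat -> {vspace E}) (lam : nat -> R).
Hypothesis L0 : L 0 = 0%VS.
Hypothesis L_succ : forall j, (L j <= L j.+1)%VS.
Hypothesis D_flag : forall j h, (j <= r)%N -> h \in L j.+1 -> D h - lam j *: h \in L j.

Let L_mono i j : (i <= j)%N -> (L i <= L j)%VS.
Proof.
move=> /subnK <-; elim: (j - i)%N => [|d IH]; first by rewrite subvv.
exact: subv_trans IH (L_succ _).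
Qed.

(** The vector [z = D h - lam j *: h] lies in [L j], which [D] preserves, so symmetry gives
    [ip z z = ip h (D z) - lam j * ip h z = 0]. *)
Lemma flag_eigen j h : (j <= r)%N -> h \in L j.+1 -> orth (L j) h -> D h = lam j *: h.
Proof.
move=> jr hL hLo; apply/eqP; rewrite -subr_eq0; apply/eqP.
have DL z : z \in L j -> D z \in L j.
  case: j jr {hL hLo} => [|j] jr zL.
    by move: zL; rewrite L0 !memv0 => /eqP ->; have := DZ 0 0; rewrite !scale0r => ->.
  rewrite -[D z](subrK (lam j *: z)) memvD ?memvZ //.
  by apply: (subvP (L_succ _)); apply: D_flag; rewrite // ltnW.
have zL := D_flag jr hL; have DzL := DL _ zL; set z := _ - _ in zL DzL *.
apply: ip_eq0; rewrite {1}/z ipBl ipZl D_sym !hLo // mulr0 subrr //.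
Qed.

Hypothesis gap : forall j, (2 <= j <= r)%N -> lam 1%N < lam j.

(** For [h] in [L j.+1], peel off the component orthogonal to [L j]: it is an eigenvector for
    [lam j] and adds [lam j - lam 1] times its squared norm to the form. For [j >= 2] this is
    positive unless the component is zero, so equality leaves only a vector of [L 2]. *)
Lemma flag_form_ge0 j h : (j <= r.+1)%N -> h \in L j -> orth (L 1) h ->
  0 <= ip h (D h) - lam 1%N * ip h h /\
  (ip h (D h) - lam 1%N * ip h h = 0 -> h \in L 2).
Proof.
elim: j h => [|j IH] h jr hL hLo.
  by move: hL; rewrite L0 memv0 => /eqP ->; rewrite !ip0l mulr0 subrr mem0v.
have [g gL hgo] := orthogonal_decomposition (L j) h.
case: (posnP j) => [j0|j_gt0].
  have -> : h = 0 by apply: ip_eq0; apply: hLo; rewrite -j0.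
  by rewrite !ip0l mulr0 subrr mem0v.
have kL : h - g \in L j.+1 by rewrite memvB ?(subvP (L_succ j) _ gL).
have Dk : D (h - g) = lam j *: (h - g) by exact: flag_eigen.
set k := h - g in kL hgo Dk *.
have hE : h = g + k by rewrite addrC subrK.
have kE : k = h - g by []; clearbody k.
have go : orth (L 1) g.
  by move=> u uL; rewrite -[g](subKr h) -kE ipBl hLo // hgo ?subr0 // (subvP (L_mono j_gt0)).
have gk : ip k g = 0 by exact: hgo.
have [Mg_ge0 Mg0] := IH g (ltnW jr) gL go.
have -> : ip h (D h) - lam 1%N * ip h h
   = (ip g (D g) - lam 1%N * ip g g) + (lam j - lam 1%N) * ip k k.
  rewrite hE DD Dk !ipDl !ipDr !ipZr -(D_sym k) Dk ipZl (ipC g k) gk; ring.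
have [j1|j_neq1] := eqVneq j 1%N.
  by subst j; rewrite subrr mul0r addr0; split=> // _; rewrite hE memvD ?(subvP (L_succ 1)).
have lt_lam : 0 < lam j - lam 1%N by rewrite subr_gt0 gap //; lia.
have kk : 0 <= (lam j - lam 1%N) * ip k k by rewrite mulr_ge0 // ltW.
split=> [|/eqP]; first exact: addr_ge0.
rewrite paddr_eq0 // => /andP [/eqP /Mg0 g2].
by rewrite mulf_eq0 gt_eqF //= => /eqP /ip_eq0 k0; rewrite hE k0 addr0.
Qed.

Variable one : E.
Hypothesis one_neq0 : one != 0.
Hypothesis L1 : L 1 = <[one]>%VS.

(* [h] stands for the characteristic vector of an independent set, [D] for the
   adjacency operator. *)
Lemma flag_ratio_bound h : h \in L r.+1 -> ip h (D h) = 0 -> ip h one = ip h h ->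
  (lam 0%N - lam 1%N) * ip h h ^+ 2 <= - lam 1%N * ip one one * ip h h /\
  ((lam 0%N - lam 1%N) * ip h h ^+ 2 = - lam 1%N * ip one one * ip h h -> h \in L 2).
Proof.
move=> hL hDh hone; have N0 := ip_gt0 one_neq0; set N := ip one one in N0 *.
have L1one : one \in L 1 by rewrite L1 memv_line.
have Done : D one = lam 0%N *: one.
  by apply: (@flag_eigen 0) => // u; rewrite L0 memv0 => /eqP ->; rewrite ipC ip0l.
(* Since [ip h one = s], subtracting [(s / N) *: one] makes [g] orthogonal to [L 1]. *)
set s := ip h h in hone *; set g := h - (s / N) *: one.
have oneL2 : one \in L 2 by exact: (subvP (L_succ 1)).
have go : orth (L 1) g.
  move=> u; rewrite L1 => /vlineP [c ->].
  by rewrite ipZr ipBl ipZl hone -/N divfK ?lt0r_neq0 // subrr mulr0.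
have gL : g \in L r.+1 by rewrite memvB ?memvZ // (subvP (L_mono (ltn0Sn r)) _ L1one).
have [g_ge0 g_eq0] := flag_form_ge0 (leqnn _) gL go.
(* Expanding [ip h (D h) = 0] along [h = g + (s / N) *: one] turns the form at [g], up to the factor
   [N], into the difference of the two sides of the bound. *)
have E1 : (ip g (D g) - lam 1%N * ip g g) * N
          = - lam 1%N * N * s - (lam 0%N - lam 1%N) * s ^+ 2.
  have Dg1 : ip g one = 0 by exact: go.
  have hE : h = g + (s / N) *: one by rewrite subrK.
  clearbody g.
  move: hDh; rewrite {1 2}hE DD DZ Done !ipDl !ipDr !ipZl !ipZr.
  rewrite -(D_sym one) Done ipZl (ipC one g) Dg1 -/N => hDh.
  have sE : s = s / N * (s / N * N) + ip g g.
    rewrite {1}/s {1 2}hE !ipDl !ipDr !ipZl !ipZr (ipC one g) Dg1 -/N; ring.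
  have -> : ip g (D g) = - (s / N * (s / N * (lam 0%N * N))) by lra.
  have -> : ip g g = s - s / N * (s / N * N) by lra.
  by field; rewrite lt0r_neq0.
split; first by rewrite -subr_ge0 -E1 pmulr_lge0.
move=> eqs; have /eqP : (ip g (D g) - lam 1%N * ip g g) * N = 0 by rewrite E1 eqs subrr.
rewrite mulf_eq0 (gt_eqF N0) orbF => /eqP /g_eq0 g2.
by rewrite -[h](subrK ((s / N) *: one)) memvD ?memvZ.
Qed.
End Flag.

(** Induction principle for a span, usable for properties that are existential rather than
    membership in a subspace. *)
Lemma span_closed (K : fieldType) (E : vectType K) (P : E -> Prop) (X : seq E) :
  P 0 -> (forall f g, P f -> P g -> P (f + g)) -> (forall a f, P f -> P (a *: f)) ->
  (forall x, x \in X -> P x) -> forall h, h \in <<X>>%VS -> P h.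
Proof.
move=> P0 PD PZ; elim: X => [|x X IH] PX h.
  by rewrite span_nil memv0 => /eqP ->.
rewrite span_cons => /memv_addP [_ /vlineP [c ->] [g gX ->]].
apply: PD; first by apply/PZ/PX; rewrite mem_head.
by apply: IH gX => y yX; apply: PX; rewrite inE yX orbT.
Qed.

(** * The spectrum of the q-Kneser graph *)

Section QKneser.
Variables (F : finFieldType) (n : nat).
Local Notation q := (#|F|%:R : rat).
Local Notation sub := {vspace 'rV[F]_n}.
Implicit Types (I J K U W Z x p : sub).

Lemma dim_full : \dim {:'rV[F]_n} = n.
Proof. by rewrite dimvf /dim /= mul1n. Qed.

(** No factor of the counting formula vanishes when [k + \dim U <= \dim Z]. *)
Lemma between_nonempty J U Z k :
  (J <= Z)%VS -> (U <= Z)%VS -> (J :&: U = 0)%VS -> (\dim J <= k)%N ->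
  (k + \dim U <= \dim Z)%N -> exists W, W \in between J U Z k.
Proof.
move=> JZ UZ JU Jk kU; apply/set0Pn; rewrite -cards_eq0 -(eqr_nat rat).
rewrite (card_between JZ UZ JU Jk) prodf_seq_neq0; apply/allP => i.
rewrite mem_index_iota => /andP [_ ik] /=.
by rewrite mulf_neq0 ?invr_eq0 // subr_eq0 gt_eqF // expq_lt //; lia.
Qed.

(** The Moebius function of the subspace lattice, from zero to a subspace of dimension [i]. *)
Definition mobius (i : nat) : rat := (-1) ^+ i * q ^+ 'C(i, 2).

Lemma mobiusS i : mobius i.+1 = - (q ^+ i * mobius i).
Proof. by rewrite /mobius binS bin1 exprS exprD; ring. Qed.

(* Subspaces avoiding a fixed line [P] of [K] are paired off with those
   containing it through [I |-> I + P]; each [I' >= P] has [q ^ (dim I' - 1)] preimages. *)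
Lemma sum_mobius K : \sum_(I | (I <= K)%VS) mobius (\dim I) = (K == 0%VS)%:R.
Proof.
have [->|K0] := eqVneq K 0%VS.
  by rewrite (big_pred1 0%VS) => [|I]; rewrite ?dimv0 ?subv0 // /mobius bin0n !expr0 mulr1.
set P := (<[vpick K]>)%VS.
have PK : (P <= K)%VS by rewrite -memvE memv_pick.
have dP : \dim P = 1%N by rewrite dim_vline vpick0 K0.
rewrite (bigID (fun I => (P <= I)%VS)) /= addrC.
rewrite (partition_big (fun I => I + P)%VS (fun I' => (I' <= K)%VS && (P <= I')%VS)) /=; last first.
  by move=> I /andP [IK _]; rewrite subv_add IK PK addvSr.
rewrite -big_split /= big1 // => I' /andP [I'K PI'].
have dI' : (0 < \dim I')%N by apply: leq_trans (dimvS PI'); rewrite dP.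
(* The fibre over [I'] consists of the hyperplanes of [I'] that miss the line [P]. *)
rewrite (eq_bigl (fun I => I \in between 0 P I' (\dim I').-1)) => [|I]; last first.
  rewrite !inE sub0v /=; apply/andP/and3P => [[/andP [IK PI] /eqP IP]|[II' /eqP dI /eqP IP]].
    have vI : vpick K \notin I by rewrite memvE.
    rewrite -IP addvSl dimv_line //; split=> //.
    apply: contraNT PI => IP0; suff <- : (I :&: P = P)%VS by exact: capvSl.
    by apply/eqP; rewrite eqEdim capvSr dP lt0n dimv_eq0.
  have PI : ~~ (P <= I)%VS.
    by apply/negP => /capv_idPr PI; move: dP; rewrite -PI IP dimv0.
  rewrite (subv_trans II' I'K) PI; split=> //.
  rewrite eqEdim subv_add II' PI' dimv_line ?dI ?prednK ?leqnn // memvE.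
rewrite (eq_bigr (fun=> mobius (\dim I').-1)) => [|I]; last first.
  by rewrite inE => /and4P [_ _ /eqP -> _].
rewrite sumr_const -mulr_natl card_between ?sub0v ?cap0v ?dimv0 // dP.
case: (\dim I') dI' => // m _; rewrite mobiusS [X in X * _](_ : _ = q ^+ m) ?subrr //.
rewrite (eq_big_nat _ _ (F2 := fun=> q)) => [|i /andP [_ im]].
  by rewrite prodr_const_nat subn0.
rewrite addn1 !exprS -mulrBr mulfK // subr_eq0 gt_eqF // expq_lt //.
Qed.

(** * Functions on the [r]-spaces, filtered by degree, and the adjacency operator *)

Section Degree.
Variable r : nat.
Hypothesis le2rn : (2 * r <= n)%N.

Local Notation E := {ffun sub -> rat^o}.

(** The number of [r]-spaces that contain a given [j]-space [J] and meet a given [r]-space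
    trivially, when [J] itself does. At [j = 0] this is the valency of the graph. *)
Definition disj_count (j : nat) : rat :=
  \prod_(j <= i < r) ((q ^+ n - q ^+ (i + r)) / (q ^+ r - q ^+ i)).

Definition qK_eigenvalue (j : nat) : rat := disj_count j * mobius j.

(** Functions live on all subspaces but are supported on dimension [r]; the zero subspace gives the
    all-one vector of the graph. *)
Definition above J : E := [ffun U => ((\dim U == r) && (J <= U)%VS)%:R].

Definition qK_operator (h : E) : E :=
  [ffun U => if \dim U == r then \sum_(W | (\dim W == r) && (W :&: U == 0)%VS) h W else 0].

Definition qK_dot (f h : E) : rat := \sum_U f U * h U.

(** The inequality is strict, so index 0 gives the zero space, index 1 the constants, and index 2
    the functions of degree at most 1. *)
Definition degree_lt j : {vspace E} :=
  <<[seq above J | J <- enum [set: sub] & (\dim J < j)%N]>>%VS.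

Lemma disj_count_gt0 j : 0 < disj_count j.
Proof.
rewrite /disj_count big_nat; apply: prodr_gt0 => i /andP [_ ir].
by rewrite divr_gt0 // subr_gt0 expq_lt //; lia.
Qed.

Lemma disj_countS j : (j < r)%N ->
  disj_count j * (q ^+ r - q ^+ j) = (q ^+ n - q ^+ (j + r)) * disj_count j.+1.
Proof.
move=> jr; rewrite /disj_count big_ltn // mulrAC divfK // lt0r_neq0 //.
by rewrite subr_gt0 expq_lt.
Qed.

Lemma above_in J j : (\dim J < j)%N -> above J \in degree_lt j.
Proof. by move=> Jj; apply/memv_span/map_f; rewrite mem_filter Jj mem_enum inE. Qed.

(* The condition [J :&: U = 0] is detected by summing [mobius] over the subspaces of
   [J :&: U]. Only the term [I = J] has full degree, so the operator is triangular
   along [degree_lt], with [qK_eigenvalue] on the diagonal. *)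
Lemma qK_operator_above J : (\dim J <= r)%N ->
  qK_operator (above J) = disj_count (\dim J) *: \sum_(I | (I <= J)%VS) mobius (\dim I) *: above I.
Proof.
move=> Jr; apply/ffunP => U; rewrite !ffunE sum_ffunE.
have [dU|dU] := eqVneq; last first.
  by rewrite big1 ?scaler0 // => I _; rewrite !ffunE (negPf dU) /= scaler0.
rewrite (eq_bigr (fun W => ((J <= W)%VS)%:R)) => [|W /andP [dW _]]; last by rewrite ffunE dW.
rewrite -natr_sum -[X in _ *: X](_ : ((J :&: U)%VS == 0%VS)%:R = _); last first.
  rewrite -sum_mobius big_mkcond [RHS]big_mkcond; apply: eq_bigr => I _ /=.
  rewrite subv_cap !ffunE dU eqxx /=.
  case: (I <= J)%VS => //=.
  by case: (I <= U)%VS; rewrite [RHS](mulr1, mulr0).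
have [JU|JU] := eqVneq (J :&: U)%VS 0%VS.
  have := card_between (subvf J) (subvf U) JU Jr.
  rewrite dU dim_full => cE.
  rewrite [RHS]mulr1 /disj_count -cE -sum1_card; congr _%:R.
  rewrite -big_mkcondr /=.
  apply: eq_bigl => W; rewrite !inE subvf /= andbC.
  by [].
rewrite scaler0 big1 ?mulr0 // => W /andP [_ /eqP WU].
case JW : (J <= W)%VS => //; case/negP: JU.
by rewrite -subv0 -WU capvS.
Qed.

Lemma qK_operatorD : {morph qK_operator : f g / f + g}.
Proof.
move=> f g; apply/ffunP => U; rewrite !ffunE; case: eqP; rewrite ?addr0 // => _.
by rewrite -big_split; apply: eq_bigr => W _; rewrite ffunE.
Qed.

Lemma qK_operatorZ a : {morph qK_operator : f / a *: f}.
Proof.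
move=> f; apply/ffunP => U; rewrite !ffunE; case: eqP; rewrite ?scaler0 // => _.
by rewrite scaler_sumr; apply: eq_bigr => W _; rewrite ffunE.
Qed.

Lemma qK_dotC f g : qK_dot f g = qK_dot g f.
Proof. by apply: eq_bigr => U _; rewrite mulrC. Qed.

Lemma qK_dot_linear h : linear_for *%R (qK_dot^~ h).
Proof.
move=> a f g; rewrite /= /qK_dot mulr_sumr -big_split; apply: eq_bigr => U _.
by rewrite !ffunE mulrDl -mulrA.
Qed.

Lemma qK_dot_gt0 f : f != 0 -> 0 < qK_dot f f.
Proof.
move=> f0; have f_ge0 U : true -> 0 <= f U * f U by move=> _; rewrite -expr2 sqr_ge0.
rewrite lt0r sumr_ge0 // andbT; apply: contra f0; rewrite psumr_eq0 // => /allP f0.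
apply/eqP/ffunP => U; rewrite ffunE; apply/eqP.
by have /implyP := f0 U (mem_index_enum _); rewrite mulf_eq0 orbb; apply.
Qed.

Lemma qK_operator_sym f g : qK_dot (qK_operator f) g = qK_dot f (qK_operator g).
Proof.
rewrite /qK_dot.
under eq_bigr do rewrite ffunE.
under [RHS]eq_bigr do rewrite ffunE.
rewrite (bigID (fun U => \dim U == r)) [RHS](bigID (fun U => \dim U == r)) /=.
rewrite [X in _ + X]big1 => [|U /negPf ->]; last by rewrite mul0r.
rewrite [X in _ = _ + X]big1 => [|U /negPf ->]; last by rewrite mulr0.
rewrite !addr0.
under eq_bigr => U dU do rewrite dU mulr_suml big_mkcondr.
under [RHS]eq_bigr => U dU do rewrite dU mulr_sumr big_mkcondr.
rewrite exchange_big; apply: eq_bigr => U dU; apply: eq_bigr => W dW /=.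
by rewrite capvC; case: ifP.
Qed.

Lemma degree_lt0 : degree_lt 0 = 0%VS.
Proof.
apply/eqP; rewrite -subv0; apply/span_subvP => f /mapP [J].
by rewrite mem_filter ltn0.
Qed.

Lemma degree_lt1 : degree_lt 1 = <[above 0%VS]>%VS.
Proof.
apply/eqP; rewrite eqEsubv -memvE above_in ?dimv0 // andbT.
apply/span_subvP => f /mapP [J]; rewrite mem_filter ltnS leqn0 dimv_eq0.
by move=> /andP [/eqP -> _] ->; rewrite memv_line.
Qed.

Lemma degree_lt_succ j : (degree_lt j <= degree_lt j.+1)%VS.
Proof.
apply/span_subvP => f /mapP [J]; rewrite mem_filter => /andP [Jj _] ->.
by apply: above_in; rewrite ltnW.
Qed.

Lemma qK_operator_flag j h : (j <= r)%N -> h \in degree_lt j.+1 ->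
  qK_operator h - qK_eigenvalue j *: h \in degree_lt j.
Proof.
move=> jr; move: h.
apply: span_closed => [|f g fP gP|a f fP|f /mapP [J]].
- by have := qK_operatorZ 0 0; rewrite !scale0r scaler0 subr0 => ->; rewrite mem0v.
- by rewrite qK_operatorD scalerDr opprD addrACA memvD.
- by rewrite qK_operatorZ scalerA mulrC -scalerA -scalerBr memvZ.
rewrite mem_filter ltnS => /andP [Jj _] ->.
rewrite qK_operator_above ?(leq_trans Jj) //.
rewrite (bigD1 J) ?subvv //= scalerDr scalerA -/(qK_eigenvalue (\dim J)) addrAC -scalerBl.
apply: memvD; last first.
  apply/memvZ/memv_suml => I /andP [IJ neq]; apply/memvZ/above_in.
  by apply: leq_trans Jj; rewrite (ltn_leqif (dimv_leqif_eq IJ)).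
(* For [\dim J < j] the coefficient left over need not vanish, but then [above J] already lies in
   [degree_lt j]. *)
have [<-|neq] := eqVneq (\dim J) j; first by rewrite subrr scale0r mem0v.
by apply/memvZ/above_in; rewrite ltn_neqAle neq.
Qed.

(** The absolute values [disj_count k * q ^+ 'C(k, 2)] strictly decrease in [k], and the eigenvalue
    of index 1 is negative, so no later one is as small. *)
Lemma qK_eigenvalue_gap j : (2 <= j <= r)%N -> qK_eigenvalue 1 < qK_eigenvalue j.
Proof.
have q_gt0 k : 0 < q ^+ k by rewrite exprn_gt0 // (lt_trans ltr01) ?cardF_gt1.
have step k : (k < r)%N -> q ^+ k * disj_count k.+1 < disj_count k.
  move=> kr; have kE := disj_countS kr.
  have lt0 : 0 < q ^+ r - q ^+ k by rewrite subr_gt0 expq_lt.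
  (* Here [2 * r <= n] enters, as [r <= n - r]. *)
  have le1 : q ^+ r - q ^+ k <= q ^+ (n - r) - q ^+ k.
    by rewrite lerD2r ler_weXn2l ?(ltW (cardF_gt1 F)) //; lia.
  have nE : q ^+ n - q ^+ (k + r) = q ^+ r * (q ^+ (n - r) - q ^+ k).
    by rewrite mulrBr -!exprD subnKC ?(addnC r) //; lia.
  rewrite -(ltr_pM2r lt0) kE nE [ltLHS]mulrAC ltr_pM2r ?disj_count_gt0 //.
  apply: lt_le_trans (_ : q ^+ r * (q ^+ r - q ^+ k) <= _); last by rewrite ler_pM2l.
  by rewrite ltr_pM2r // expq_lt.
have absE k : (-1) ^+ k * qK_eigenvalue k = disj_count k * q ^+ 'C(k, 2).
  rewrite /qK_eigenvalue /mobius mulrCA; congr (_ * _).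
  by rewrite mulrA -expr2 sqrr_sign mul1r.
have dec k : (k < r)%N ->
    disj_count k.+1 * q ^+ 'C(k.+1, 2) < disj_count k * q ^+ 'C(k, 2).
  move=> kr; rewrite binS bin1 exprD mulrCA [ltRHS]mulrC ltr_pM2l //.
  by rewrite mulrC step.
have lt1 k : (1 < k <= r)%N -> disj_count k * q ^+ 'C(k, 2) < disj_count 1.
  elim: k => // k IH; rewrite ltnS => /andP [k0 kr].
  apply: lt_le_trans (dec k kr) _; case: k k0 IH kr => [//|[|k]] _ IH kr.
    by rewrite bin_small // expr0 mulr1.
  by apply/ltW/IH; lia.
move=> /lt1 jlt; have := absE 1; rewrite expr1 bin_small // expr0 mulr1 => E1.
have : `|qK_eigenvalue j| < disj_count 1.
  rewrite -[`|_|]mul1r -(normr_sign rat (odd j)) signr_odd -normrM absE ger0_norm //.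
  by rewrite mulr_ge0 ?ltW // disj_count_gt0.
by rewrite ltr_norml => /andP [+ _]; lra.
Qed.
End Degree.
End QKneser.

(** * Intersecting families of maximum size are stars *)

Section Intersecting.
Variables (F : finFieldType) (n : nat).
Local Notation q := (#|F|%:R : rat).
Local Notation sub := {vspace 'rV[F]_n}.
Implicit Types (J K U W Z x p : sub).
Local Notation "[ k ]_q" := ((qint #|F| k)%:R : rat) (at level 0, format "[ k ]_q").

Lemma qintE k : (q - 1) * [k]_q = q ^+ k - 1.
Proof.
rewrite subrX1 /qint natr_sum; congr (_ * _).
by apply: eq_bigr => i _; rewrite natrX.
Qed.

Lemma qint_gt0 k : (0 < k)%N -> 0 < [k]_q.
Proof. by case: k => // k _; rewrite ltr0n /qint big_ord_recl expn0 add1n. Qed.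

Lemma card_lines U : #|[set x | (\dim x == 1%N) && (x <= U)%VS]|%:R = [\dim U]_q.
Proof.
rewrite (_ : [set x | _] = between 0 0 U 1); last first.
  by apply/setP => x; rewrite !inE sub0v capv0 eqxx andbT andbC.
have q1 : q - 1 != 0 by rewrite subr_eq0 gt_eqF ?cardF_gt1.
rewrite card_between ?sub0v ?capv0 ?dimv0 // big_nat1 addn0 expr0 expr1.
by rewrite -qintE mulrC mulKf.
Qed.

Lemma cap_line x U : \dim x = 1%N -> ~~ (x <= U)%VS -> (x :&: U = 0)%VS.
Proof.
move=> dx; apply: contraNeq => xU0; suff <- : (x :&: U = x)%VS by exact: capvSr.
by apply/eqP; rewrite eqEdim capvSl dx lt0n dimv_eq0.
Qed.

(* Summing over the [k]-spaces of [Z] that avoid the line [p] shows that [a p] is the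
   sum of [a] over all the lines of [Z], so [a] is constant on [Z]. *)
Lemma lines_sum_eq0 (a : sub -> rat) Z k : (0 < k)%N -> \dim Z = k.+1 ->
  (forall W, (W <= Z)%VS -> \dim W = k -> \sum_(x | (\dim x == 1%N) && (x <= W)%VS) a x = 0) ->
  forall p, \dim p = 1%N -> (p <= Z)%VS -> a p = 0.
Proof.
move=> k0 dZ a0.
set S := \sum_(x | (\dim x == 1%N) && (x <= Z)%VS) a x.
have aS p : \dim p = 1%N -> (p <= Z)%VS -> a p = S.
  move=> dp pZ.
  have : \sum_(W in between 0 p Z k) \sum_(x | (\dim x == 1%N) && (x <= W)%VS) a x = 0.
    by apply: big1 => W; rewrite inE => /and4P [_ WZ /eqP dW _]; exact: a0.
  rewrite (exchange_big_dep (fun x => (\dim x == 1%N) && (x <= Z)%VS)) /=; last first.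
    move=> W x; rewrite inE => /and4P [_ WZ _ _] /andP [-> xW].
    exact: subv_trans WZ.
  rewrite (bigD1 p) ?dp ?eqxx //= big1 => [|W]; last first.
    rewrite inE => /andP [/and4P [_ _ _ /eqP Wp] /= pW].
    by move: dp; rewrite -(capv_idPr pW) Wp dimv0.
  rewrite add0r.
  (* [c] counts the [k]-spaces of [Z] that contain a given line [x] other than [p] and avoid [p]; it
     does not depend on [x]. *)
  pose c : rat := \prod_(1 <= i < k) ((q ^+ k.+1 - q ^+ (i + 1)) / (q ^+ k - q ^+ i)).
  rewrite (eq_bigr (fun x => c * a x)) => [|x /andP [/andP [/eqP dx xZ] xp]]; last first.
    have px : (x :&: p = 0)%VS.
      apply: cap_line => //; apply: contra xp => xp.
      by rewrite eqEdim xp dx dp.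
    rewrite sumr_const -mulr_natl /c -dZ.
    have := card_between xZ pZ px; rewrite dx dp => <- //; congr (_%:R * _).
    apply: eq_card => W; rewrite [LHS]unfold_in /= !inE sub0v /= andbC.
    by case: (x <= W)%VS.
  rewrite -mulr_sumr => /eqP; rewrite mulf_eq0 => /orP [c0|/eqP Sp].
    move: c0; rewrite gt_eqF // /c big_nat; apply: prodr_gt0 => i /andP [i0 ik].
    by rewrite divr_gt0 // subr_gt0 expq_lt //; lia.
  by rewrite /S (bigD1 p) /= ?Sp ?addr0 // dp pZ.
suff S0 : S = 0 by move=> p dp pZ; rewrite aS.
(* With [a] constantly [S] on the lines of [Z], a single [k]-space shows that [S] times [[k]_q] is
   zero. *)
have [W] : exists W, W \in between 0 0 Z k.
  by apply: between_nonempty; rewrite ?sub0v ?capv0 ?dimv0 ?dZ // addn0.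
rewrite inE => /and4P [_ WZ /eqP dW _].
have := a0 W WZ dW; rewrite (eq_bigr (fun=> S)) => [|x /andP [/eqP dx xW]]; last first.
  by apply: aS => //; exact: subv_trans WZ.
rewrite sumr_const -mulr_natl => /eqP; rewrite mulf_eq0 => /orP [/eqP c0|/eqP //].
have := card_lines W; rewrite dW cardsE c0 => k_eq0.
by have := qint_gt0 k0; rewrite -k_eq0 ltxx.
Qed.

(** * The ratio bound for intersecting families and its equality case *)

Section Bound.
Variable r : nat.
Hypotheses (r_gt0 : (0 < r)%N) (lt2rn : (2 * r < n)%N).
Let le2rn : (2 * r <= n)%N := ltnW lt2rn.

Variable A : {set sub}.
Hypothesis dimA : forall U, U \in A -> \dim U = r.
Hypothesis interA : forall U W, U \in A -> W \in A -> (U :&: W)%VS != 0%VS.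

Local Notation N := (#|[set U : sub | \dim U == r]|%:R : rat).

(** The generator of a line [J] has weight 1 at [J] alone; a constant is spread evenly over all
    lines, since every [r]-space has [[r]_q] of them. *)
Lemma degree1_sum_lines f : f \in degree_lt F n r 2 ->
  exists a : sub -> rat, forall U, \dim U = r ->
    f U = \sum_(x | (\dim x == 1%N) && (x <= U)%VS) a x.
Proof.
move: f; apply: span_closed => [|f g [a fa] [b gb]|c f [a fa]|f /mapP [J]].
- by exists (fun=> 0) => U _; rewrite big1 ?ffunE.
- exists (fun x => a x + b x) => U dU; rewrite ffunE fa // gb //.
  by rewrite big_split.
- by exists (fun x => c * a x) => U dU; rewrite ffunE fa // -mulr_sumr.
rewrite mem_filter => /andP [dJ _] ->.
case: (posnP (\dim J)) => [/eqP|J_gt0].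
  rewrite dimv_eq0 => /eqP ->; exists (fun=> [r]_q^-1) => U dU.
  rewrite ffunE dU eqxx sub0v sumr_const -[_^-1 *+ _]mulr_natl.
  have := card_lines U; rewrite cardsE dU => ->; rewrite mulfV //.
  by rewrite gt_eqF ?qint_gt0.
have {}dJ : \dim J = 1%N by lia.
exists (fun x => (x == J)%:R) => U dU; rewrite ffunE dU eqxx /=.
case JU: (J <= U)%VS.
  rewrite (bigD1 J) /= ?dJ ?JU // eqxx big1 ?addr0 // => x /andP [_ /negPf ->] //.
rewrite big1 // => x /andP [_ xU]; case: eqP => // xJ.
by rewrite -xJ xU in JU.
Qed.

(** An intersecting family is an independent set of the graph, so the ratio bound applies with the
    valency and the least eigenvalue, of indices 0 and 1. Equality forces degree at most 1. *)
Lemma intersecting_bound :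
  #|A|%:R * [n]_q <= N * [r]_q /\
  (#|A|%:R * [n]_q = N * [r]_q -> exists a : sub -> rat, forall U, \dim U = r ->
    (U \in A)%:R = \sum_(x | (\dim x == 1%N) && (x <= U)%VS) a x).
Proof.
pose h : {ffun sub -> rat^o} := [ffun U => (U \in A)%:R].
have hE : h = \sum_(U in A) above r U.
  apply/ffunP => W; rewrite sum_ffunE !ffunE; case: (boolP (W \in A)) => WA.
    rewrite (bigD1 W) //= ffunE dimA // eqxx subvv big1 ?addr0 // => U /andP [UA UW].
    rewrite ffunE dimA // eqxx /=; case UleW : (U <= W)%VS => //; case/negP: UW.
    by rewrite eqEdim UleW (dimA UA) (dimA WA) leqnn.
  rewrite big1 // => U UA; rewrite ffunE; case: eqP => //= dW; case UleW : (U <= W)%VS => //.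
  by case/negP: WA; rewrite -(_ : U = W) //; apply/eqP; rewrite eqEdim UleW dW (dimA UA) leqnn.
have hL : h \in degree_lt F n r r.+1.
  by rewrite hE; apply: memv_suml => U UA; apply: above_in; rewrite dimA.
have hh : qK_dot h h = #|A|%:R.
  rewrite -sum1_card natr_sum big_mkcond; apply: eq_bigr => U _; rewrite !ffunE.
  by case: (U \in A); rewrite ?mulr1 ?mulr0.
have h1 : qK_dot h (above r 0) = qK_dot h h.
  apply: eq_bigr => U _; rewrite !ffunE sub0v andbT.
  by case: (boolP (U \in A)) => [/dimA ->|_]; rewrite ?eqxx ?mul0r.
have N1 : qK_dot (above r 0 : {ffun sub -> rat^o}) (above r 0) = N.
  rewrite -sum1_card natr_sum big_mkcond; apply: eq_bigr => U _; rewrite !ffunE sub0v andbT inE.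
  by case: (_ == _); rewrite ?mulr1 ?mulr0.
have hDh : qK_dot h (qK_operator r h) = 0.
  apply: big1 => U _; rewrite !ffunE; case: (boolP (U \in A)) => UA; last by rewrite mul0r.
  rewrite dimA // eqxx mul1r big1 // => W /andP [_ WU]; rewrite ffunE.
  by case: (boolP (W \in A)) => // WA; case/negP: (interA WA UA).
have [Wr Wrin] : exists W : sub, W \in between 0 0 fullv r.
  apply: between_nonempty; rewrite ?sub0v ?capv0 ?dimv0 ?dim_full // addn0; lia.
have one0 : above r 0 != 0 :> {ffun sub -> rat^o}.
  apply/eqP => /ffunP /(_ Wr); rewrite !ffunE sub0v andbT.
  by move: Wrin; rewrite inE => /and4P [_ _ -> _] /eqP; rewrite oner_eq0.
have := flag_ratio_bound (@qK_dotC F n) (@qK_dot_linear F n) (@qK_dot_gt0 F n)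
  (@qK_operatorD F n r) (@qK_operatorZ F n r) (@qK_operator_sym F n r)
  (degree_lt0 F n r) (@degree_lt_succ F n r)
  (@qK_operator_flag F n r)
  (@qK_eigenvalue_gap F n r le2rn) one0 (degree_lt1 F n r) hL hDh h1.
rewrite hh N1; set s := #|A|%:R; set N0 := #|_|%:R.
have -> : qK_eigenvalue F n r 0 = disj_count F n r 0.
  by rewrite /qK_eigenvalue /mobius expr0 bin0n expr0 !mulr1.
have -> : qK_eigenvalue F n r 1 = - disj_count F n r 1.
  by rewrite /qK_eigenvalue /mobius expr1 bin_small // expr0 mulr1 mulrN1.
have c1 := disj_count_gt0 F le2rn 1.
have cE := disj_countS F n r_gt0.
set c := disj_count F n r 1 in c1 cE *; set c' := disj_count F n r 0 in cE *.
(* The case [j = 0] of [disj_countS] rewrites the ratio [c / (c' + c)] as [[r]_q / [n]_q]. *)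
have cc : (c' + c) * [r]_q = c * [n]_q.
  have q1 : q - 1 != 0 by rewrite subr_eq0 gt_eqF ?cardF_gt1.
  apply: (mulfI q1); have := qintE n; have := qintE r; rewrite add0n expr0 in cE.
  move=> Er En; rewrite mulrCA Er [RHS]mulrCA En; lra.
have rq := qint_gt0 r_gt0.
rewrite !opprK => - [le_s eq_s].
have N_gt0 : 0 < N0.
  rewrite ltr0n; apply/card_gt0P; exists Wr.
  by move: Wrin; rewrite !inE => /and4P [].
(* The empty family is treated apart because [flag_ratio_bound] carries a factor [s] on both
   sides. *)
have [s0|s0] := eqVneq s 0.
  rewrite s0 mul0r ltW ?mulr_gt0 //; split=> // /eqP.
  by rewrite lt_eqF ?mulr_gt0.
have s_gt0 : 0 < s by rewrite lt0r s0 ler0n.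
have E1 : ((c' + c) * s ^+ 2) * [r]_q = c * s * (s * [n]_q) by rewrite mulrAC cc; ring.
have E2 : c * N0 * s * [r]_q = c * s * (N0 * [r]_q) by ring.
have cs : 0 < c * s by rewrite mulr_gt0.
split; first by rewrite -(ler_pM2l cs) -E1 -E2 ler_pM2r.
move=> eqA; have hL2 : h \in degree_lt F n r 2.
  by apply: eq_s; apply: (mulIf (lt0r_neq0 rq)); rewrite E1 E2 eqA.
have [a ha] := degree1_sum_lines hL2.
by exists a => U dU; rewrite -ha // ffunE.
Qed.

(** Stars attain the bound, so an extremal family contained in a star is the whole star. *)
Lemma card_star p : \dim p = 1%N ->
  #|[set U : sub | (\dim U == r) && (p <= U)%VS]|%:R * [n]_q = N * [r]_q.
Proof.
move=> dp.
rewrite (_ : [set U | _ & _] = between p 0 fullv r); last first.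
  by apply/setP => U; rewrite !inE subvf capv0 eqxx andbT andbC.
rewrite (_ : [set U | _] = between 0 0 fullv r); last first.
  by apply/setP => U; rewrite !inE subvf sub0v capv0 eqxx andbT.
rewrite !card_between ?subvf ?sub0v ?capv0 ?dimv0 ?dp //.
rewrite [in RHS]big_ltn // addn0 dim_full expr0 [RHS]mulrAC mulrC; congr (_ * _).
have r0 : q ^+ r - 1 != 0 by rewrite subr_eq0 gt_eqF // -(expr0 q) expq_lt.
have q1 : q - 1 != 0 by rewrite subr_eq0 gt_eqF ?cardF_gt1.
by apply: (mulfI q1); rewrite qintE mulrCA qintE divfK.
Qed.

Lemma intersecting_star : #|A|%:R * [n]_q = N * [r]_q ->
  exists p, \dim p = 1%N /\ forall U, \dim U = r -> (U \in A) = (p <= U)%VS.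
Proof.
move=> eqA; have [_ /(_ eqA) [a aP]] := intersecting_bound.
have a_supp U x : U \in A -> \dim x = 1%N -> ~~ (x <= U)%VS -> a x = 0.
  move=> UA dx xU; have xU0 := cap_line dx xU.
  have [Z] : exists Z, Z \in between x U fullv r.+1.
    by apply: between_nonempty; rewrite ?subvf ?dx // (dimA UA) dim_full; lia.
  rewrite inE => /and4P [xZ _ /eqP dZ /eqP ZU].
  apply: (lines_sum_eq0 r_gt0 dZ) dx xZ => W WZ dW; rewrite -aP //.
  case: (boolP (W \in A)) => // WA; case/negP: (interA WA UA).
  by rewrite -subv0 -ZU capvS.
have [U0 U0A] : exists U, U \in A.
  apply/set0Pn; rewrite -card_gt0 -(ltr0n rat) -(pmulr_lgt0 _ (qint_gt0 _ : 0 < [n]_q)) ?eqA; last lia.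
  rewrite mulr_gt0 ?qint_gt0 // ltr0n.
  have [W Win] : exists W : sub, W \in between 0 0 fullv r.
    apply: between_nonempty; rewrite ?sub0v ?capv0 ?dimv0 ?dim_full // addn0; lia.
  by apply/card_gt0P; exists W; move: Win; rewrite !inE => /and4P [].
(* The weights over [U0] add up to 1, so some line [p] has nonzero weight; by [a_supp] it lies in
   every member of [A]. *)
have [p /andP [/eqP dp pU0] ap] : exists2 p, (\dim p == 1%N) && (p <= U0)%VS & a p != 0.
  apply/exists_inP; apply: contraT; rewrite negb_exists_in => /forall_inP a0.
  have := aP U0 (dimA U0A); rewrite U0A big1 => [/eqP|x xU]; first by rewrite oner_eq0.
  by apply/eqP; rewrite -[_ == _]negbK a0.
have subA : A \subset [set U : sub | (\dim U == r) && (p <= U)%VS].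
  apply/subsetP => U UA; rewrite inE (dimA UA) eqxx /=.
  by apply: contraNT ap => pU; rewrite (a_supp U).
exists p; split=> // U dU.
suff -> : A = [set U : sub | (\dim U == r) && (p <= U)%VS] by rewrite inE dU eqxx.
apply/eqP; rewrite eqEcard subA -(ler_nat rat) -(ler_pM2r (qint_gt0 _ : 0 < [n]_q)); last lia.
by rewrite card_star // eqA lexx.
Qed.
End Bound.
End Intersecting.

(** * Homomorphisms *)

(** Choose [K] of dimension [k], then [U] above [K], then [W] above [K] avoiding a complement of [K]
    in [U]; the modular law gives [U :&: W = K]. *)
Lemma capv_of_dim (F : finFieldType) (n r k : nat) : (k <= r)%N -> (2 * r <= n)%N ->
  exists U W : {vspace 'rV[F]_n}, [/\ \dim U = r, \dim W = r & \dim (U :&: W) = k].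
Proof.
move=> kr rn.
have [K] : exists K : {vspace 'rV[F]_n}, K \in between 0 0 fullv k.
  by apply: between_nonempty; rewrite ?sub0v ?capv0 ?dimv0 ?dim_full // addn0; lia.
rewrite inE => /and4P [_ _ /eqP dK _].
have [U] : exists U : {vspace 'rV[F]_n}, U \in between K 0 fullv r.
  by apply: between_nonempty; rewrite ?subvf ?sub0v ?capv0 ?dimv0 ?dim_full ?dK // addn0; lia.
rewrite inE => /and4P [KU _ /eqP dU _].
have KC : (K :&: (U :\: K) = 0)%VS by rewrite capvC capv_diff.
have dC : (\dim (U :\: K) <= r)%N by rewrite -dU dimvS ?diffvSl.
have [W] : exists W : {vspace 'rV[F]_n}, W \in between K (U :\: K)%VS fullv r.
  by apply: between_nonempty; rewrite ?subvf ?dim_full ?dK //; lia.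
rewrite inE => /and4P [KW _ /eqP dW /eqP WC].
exists U, W; split=> //; rewrite -dK; congr (\dim _).
have {1}-> : U = (K + (U :\: K))%VS by rewrite addvC addv_diff; symmetry; apply/addv_idPl.
by rewrite -vspace_modl // capvC WC addv0.
Qed.

Section Homomorphism.
Variables (F F' : finFieldType) (n r n' r' : nat).
Hypotheses (r_gt0 : (0 < r)%N) (r'_gt0 : (0 < r')%N) (lt2rn : (2 * r < n)%N).
Hypothesis (eq_ratio : (qint #|F| n)%:R / (qint #|F| r)%:R
                     = (qint #|F'| n')%:R / (qint #|F'| r')%:R :> rat).
Variable f : {vspace 'rV[F]_n} -> {vspace 'rV[F']_n'}.
Hypothesis f_hom : @qK_hom F F' n r n' r' f.

Local Notation sub := {vspace 'rV[F]_n}.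
Local Notation sub' := {vspace 'rV[F']_n'}.
Local Notation "[ k ]_q" := ((qint #|F| k)%:R : rat) (at level 0, format "[ k ]_q").
Local Notation "[ k ]_q'" := ((qint #|F'| k)%:R : rat) (at level 0, format "[ k ]_q'").

Lemma eq_cross : [n]_q * [r']_q' = [n']_q' * [r]_q.
Proof.
have := qint_gt0 F r_gt0; have := qint_gt0 F' r'_gt0 => h' h.
by move/eqP: eq_ratio; rewrite eqr_div ?lt0r_neq0 // => /eqP.
Qed.

Definition pullback (p' : sub') : {set sub} := [set U | (\dim U == r) && (p' <= f U)%VS].

Lemma pullback_dim p' U : U \in pullback p' -> \dim U = r.
Proof. by rewrite inE => /andP [/eqP]. Qed.

Lemma pullback_inter p' : \dim p' = 1%N -> forall U W, U \in pullback p' -> W \in pullback p' ->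
  (U :&: W)%VS != 0%VS.
Proof.
move=> dp' U W; rewrite !inE => /andP [/eqP dU pU] /andP [/eqP dW pW].
apply/eqP => UW; have [_ /(_ U W dU dW UW) fUW] := f_hom.
suff : (p' <= 0)%VS by rewrite subv0 => /eqP p0; move: dp'; rewrite p0 dimv0.
by rewrite -fUW subv_cap pU.
Qed.

(* The pullbacks cover every vertex [r']_q' times, so on average they attain the
   bound on intersecting families; hence each of them does. *)
Lemma card_pullback p' : \dim p' = 1%N ->
  #|pullback p'|%:R * [n]_q = #|[set U : sub | \dim U == r]|%:R * [r]_q.
Proof.
move=> dp'; apply/eqP; rewrite eq_sym -subr_eq0; apply/eqP.
set N := #|[set U : sub | _]|%:R.
have ge0 x' : \dim x' == 1%N -> 0 <= N * [r]_q - #|pullback x'|%:R * [n]_q.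
  move=> /eqP dx'; rewrite subr_ge0.
  by have [] := intersecting_bound r_gt0 lt2rn (@pullback_dim x') (pullback_inter dx').
(* A double count gives [N * [r']_q'] for the sum of the pullback sizes, and there are [[n']_q']
   lines, so by [eq_cross] the nonnegative deficits add up to zero. *)
have sum0 : \sum_(x' : sub' | \dim x' == 1%N) (N * [r]_q - #|pullback x'|%:R * [n]_q) = 0.
  rewrite sumrB sumr_const -[X in X - _]mulr_natl -[X in _ - X]mulr_suml.
  have -> : \sum_(x' : sub' | \dim x' == 1%N) (#|pullback x'|%:R : rat) = N * [r']_q'.
    transitivity (\sum_(x' : sub' | \dim x' == 1%N)
        \sum_(U : sub | (\dim U == r) && (x' <= f U)%VS) (1 : rat)).
      by apply: eq_bigr => x' _; rewrite -sum1_card natr_sum; apply: eq_bigl => U; rewrite inE.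
    rewrite (exchange_big_dep (fun U : sub => \dim U == r)) /=; last by move=> x' U _ /andP [].
    rewrite /N mulr_natl -sumr_const big_set /=; apply: eq_bigr => U dU.
    have [fr _] := f_hom; rewrite -(fr U (eqP dU)) -card_lines -sum1_card natr_sum.
    by apply: eq_bigl => x'; rewrite inE dU.
  have -> : #|[pred x' : sub' | \dim x' == 1%N]|%:R = [n']_q'.
    rewrite -[in RHS](dim_full F' n') -card_lines; congr _%:R.
    by apply: eq_card => x'; rewrite !inE subvf andbT.
  by rewrite mulrCA -eq_cross; ring.
by have /(_ p') := psumr_eq0P ge0 sum0; apply; apply/eqP.
Qed.

Lemma line_map : exists phi : sub' -> sub, forall p', \dim p' = 1%N ->
  \dim (phi p') = 1%N /\ forall U, \dim U = r -> (p' <= f U)%VS = (phi p' <= U)%VS.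
Proof.
suff /fin_all_exists [phi phiP] : forall p' : sub', exists p : sub, \dim p' = 1%N ->
    \dim p = 1%N /\ forall U, \dim U = r -> (p' <= f U)%VS = (p <= U)%VS by exists phi.
(* Only lines matter; for any other subspace the zero space is a default value. *)
move=> p'; case: (eqVneq (\dim p') 1%N) => [dp'|/eqP]; last by exists 0%VS.
have [p [dp pP]] := intersecting_star r_gt0 lt2rn (@pullback_dim p') (pullback_inter dp') (card_pullback dp').
by exists p => _; split=> // U dU; rewrite -pP // inE dU eqxx.
Qed.

(** [m] is the common fibre size of the map on lines. The lines of [f U :&: f W] are exactly those
    sent into [U :&: W], so the fibre sizes add up to [[r']_q'] over each [r]-space, and
    [lines_sum_eq0], applied to their deviations from the mean, makes them constant. *)
Lemma fiber_count : exists m : nat,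
  [/\ (m%:R * [r]_q = [r']_q'), (m%:R * [n]_q = [n']_q') &
    forall U W : sub, \dim U = r -> \dim W = r ->
      m%:R * [\dim (U :&: W)]_q = [\dim (f U :&: f W)]_q'].
Proof.
have [phi phiP] := line_map.
pose w p := #|[set p' : sub' | (\dim p' == 1%N) && (phi p' == p)]|.
have sum_w U W : \dim U = r -> \dim W = r ->
    \sum_(p | (\dim p == 1%N) && (p <= U :&: W)%VS) (w p)%:R = [\dim (f U :&: f W)]_q'.
  move=> dU dW; rewrite -card_lines -sum1_card natr_sum.
  rewrite (partition_big phi (fun p => (\dim p == 1%N) && (p <= U :&: W)%VS)) /=; last first.
    move=> p'; rewrite inE => /andP [/eqP dp' pUW].
    have [-> pP] := phiP p' dp'; rewrite eqxx subv_cap -!pP //.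
    by rewrite -subv_cap.
  apply: eq_bigr => p /andP [_ pUW]; rewrite /w -sum1_card natr_sum; apply: eq_bigl => p'.
  rewrite !inE; case: eqP => //= dp'; rewrite andbC.
  have [_ pP] := phiP p' dp'; case: eqP => //= pE.
  by rewrite subv_cap !pP // -subv_cap pE pUW.
have rq := qint_gt0 F r_gt0.
(* [c] is the mean of [w] over the lines of any [r]-space. *)
pose c := [r']_q' / [r]_q.
have wE p : \dim p = 1%N -> (w p)%:R = c.
  move=> dp; apply/eqP; rewrite -subr_eq0; apply/eqP.
  have [Z] : exists Z : sub, Z \in between p 0 fullv r.+1.
    by apply: between_nonempty; rewrite ?subvf ?sub0v ?capv0 ?dimv0 ?dp // dim_full; lia.
  rewrite inE => /and4P [pZ _ /eqP dZ _].
  apply: (lines_sum_eq0 (a := fun p => (w p)%:R - c) r_gt0 dZ) dp pZ => W _ dW.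
  rewrite sumrB -{1}(capvv W) sum_w // capvv sumr_const -[X in _ - X]mulr_natl.
  have := card_lines W; rewrite cardsE => ->; have [fr _] := f_hom.
  by rewrite (fr W dW) dW /c mulrCA divff ?gt_eqF // mulr1 subrr.
(* The fibre over one line [p0] exhibits the constant as a natural number. *)
have [p0] : exists p : sub, p \in between 0 0 fullv 1.
  by apply: between_nonempty; rewrite ?sub0v ?capv0 ?dimv0 ?dim_full // addn0; lia.
rewrite inE => /and4P [_ _ /eqP dp0 _].
have mE : (w p0)%:R * [r]_q = [r']_q' by rewrite wE // divfK ?gt_eqF.
exists (w p0); split=> // [|U W dU dW].
  by apply: (mulIf (lt0r_neq0 rq)); rewrite -eq_cross mulrAC mE mulrC.
rewrite -sum_w // (eq_bigr (fun=> (w p0)%:R)) => [|p /andP [/eqP dp _]]; last by rewrite !wE.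
by rewrite sumr_const -[RHS]mulr_natl mulrC -card_lines cardsE.
Qed.

End Homomorphism.

Theorem theorem5p3 (F F' : finFieldType) (n r n' r' : nat) :
  (0 < r)%N -> (0 < r')%N -> (2 * r < n)%N -> (2 * r' < n')%N ->
  (qint #|F| n)%:R / (qint #|F| r)%:R = (qint #|F'| n')%:R / (qint #|F'| r')%:R :> rat ->
  (exists f : {vspace 'rV[F]_n} -> {vspace 'rV[F']_n'}, @qK_hom F F' n r n' r' f) ->
  (forall k : nat, (1 <= k <= r)%N ->
     exists2 k' : nat, (1 <= k' <= r')%N &
       (qint #|F| k)%:R / (qint #|F| r)%:R = (qint #|F'| k')%:R / (qint #|F'| r')%:R :> rat)
  /\ (exists m : nat, qint #|F'| n' = (m * qint #|F| n)%N)
  /\ (exists m : nat, qint #|F'| r' = (m * qint #|F| r)%N).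
Proof.
move=> r_gt0 r'_gt0 lt2rn _ eq_ratio [f f_hom].
have [m [mr mn mUW]] := fiber_count r_gt0 r'_gt0 lt2rn eq_ratio f_hom.
split; last by split; exists m; apply/eqP; rewrite -(eqr_nat rat) natrM ?mr ?mn.
move=> k /andP [k_gt0 kr].
have [U [W [dU dW dUW]]] := capv_of_dim F kr (ltnW lt2rn).
have kE := mUW U W dU dW; rewrite dUW in kE.
have rq := qint_gt0 F r_gt0; have kq := qint_gt0 F k_gt0; have r'q := qint_gt0 F' r'_gt0.
have m0 : (m%:R : rat) != 0 by apply: contraTneq r'q => m0; rewrite -mr m0 mul0r ltxx.
(* With [k'] this dimension, [m * [k]_q = [k']_q'] and [m * [r]_q = [r']_q'], so [m] cancels in the
   ratio. *)
exists (\dim (f U :&: f W)); last first.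
  by rewrite -kE -mr -mulf_div divff // mul1r.
(* The dimension is positive because [m * [k]_q] is nonzero, and at most [r'] because the
   intersection lies in [f U]. *)
rewrite lt0n; apply/andP; split.
  apply/eqP => d0; move: kE; rewrite d0 {2}/qint big_ord0 => /eqP.
  by rewrite mulf_eq0 (negPf m0) gt_eqF.
by have [/(_ U dU) <- _] := f_hom; rewrite dimvS ?capvSl.
Qed.
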